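(* Let $X\in\mathbb{O}^{n\times k}$ satisfy $\operatorname{rank}(X^{T}D)=\operatorname{rank}(D)$, i.e., $X\in\mathbb{O}_D^{n\times k}$. (a) If $X$ is a $D$-regular solution to the NEPv $H(X)X=X\Lambda$, then $X$ is a solution to the aligned NEPv $G(X)X=X\Lambda$. (b) If $X$ is a solution to the aligned NEPv $G(X)X=X\Lambda$, then any alignment $\widetilde X\in[\![X]\!]$ is a $D$-regular solution to the NEPv, i.e., $H(\widetilde X)\widetilde X=\widetilde X\widetilde\Lambda$ for some $\widetilde\Lambda\in\mathbb{R}^{k\times k}$, $\widetilde X^{T}D\succeq0$ and $\operatorname{rank}(\widetilde X^{T}D)=\operatorname{rank}(D)$.
   Context: Let $1\le k\le n$, $\mathbb{O}^{n\times k}:=\{X\in\mathbb{R}^{n\times k}: X^{T}X=I_k\}$, $D\in\mathbb{R}^{n\times k}$. A function $F$ on $\mathbb{R}^{n\times k}$ is unitarily invariant if $F(XQ)=F(X)$ for all $X\in\mathbb{R}^{n\times k}$, $Q\in\mathbb{O}^{k\times k}$. Let $\phi,\psi:\mathbb{R}^{n\times k}\to\mathbb{R}$ be continuously differentiable and unitarily invariant with $\psi(X)>0$ for all $X\in\mathbb{O}^{n\times k}$, and let $f(X):=\phi(X)+\psi(X)\operatorname{tr}(X^{T}D)$. With $\frac{\partial\phi(X)}{\partial X}\in\mathbb{R}^{n\times k}$ the matrix of partial derivatives $\partial\phi/\partial x_{ij}$ (all entries of $X$ independent), fix continuous, symmetric-matrix-valued, unitarily invariant functions $H_\phi,H_\psi:\mathbb{R}^{n\times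 k}\to\mathbb{R}^{n\times n}$ with $\frac{\partial \phi(X)}{\partial X}=H_\phi(X)X$ and $\frac{\partial \psi(X)}{\partial X}=H_\psi(X)X$ for all $X\in\mathbb{O}^{n\times k}$ (such functions exist). Define $$H(X)=H_\phi(X)+\operatorname{tr}(X^{T}D)\,H_\psi(X)+\psi(X)\,(DX^{T}+XD^{T}).$$ A solution of the NEPv $H(X)X=X\Lambda$ is an $X\in\mathbb{O}^{n\times k}$ for which this equation holds with some $\Lambda\in\mathbb{R}^{k\times k}$. It is called $D$-regular if $X^{T}D\succeq0$ (symmetric positive semidefinite) and $\operatorname{rank}(X^{T}D)=\operatorname{rank}(D)$. The set of alignments of $X\in\mathbb{O}^{n\times k}$ is $[\![X]\!]:=\{XQ: Q\in\arg\max_{Q\in\mathbb{O}^{k\times k}} f(XQ)\}$. Let $\mathbb{O}_D^{n\times k}:=\{X\in\mathbb{O}^{n\times k}:\operatorname{rank}(X^{T}D)=\operatorname{rank}(D)\}$. For $X\in\mathbb{O}_D^{n\times k}$ the matrix $H(\widetilde X)$ is the same for all $\widetilde X\in[\![X]\!]$, and one defines $G(X):=H(\widetilde X)$ for any $\widetilde X\in[\![X]\!]$. A solution of the aligned NEPv $G(X)X=X\Lambda$ is an $X\in\mathbb{O}_D^{n\times k}$ for which this equation holds with some $\Lambda\in\mathbb{R}^{k\times k}$. *)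

(* Defs.v *)
From mathcomp Require Import all_boot all_order all_algebra.
From mathcomp Require Import all_classical all_reals all_analysis.
Import Order.TTheory GRing.Theory Num.Theory.
Import numFieldNormedType.Exports.

Set Implicit Arguments.
Unset Strict Implicit.
Unset Printing Implicit Defensive.

Local Open Scope classical_set_scope.
Local Open Scope ring_scope.

Definition stiefel (R : realType) (n k : nat) : set 'M[R]_(n, k) :=
  [set X | X^T *m X = 1%:M].
Arguments stiefel : clear implicits.

Definition unitarily_invariant (R : realType) (n k : nat) (T : Type)
    (F : 'M[R]_(n, k) -> T) : Prop :=
  forall (X : 'M[R]_(n, k)) (Q : 'M[R]_k), stiefel R k k Q -> F (X *m Q) = F X.

Definition gradmx (R : realType) (n k : nat) (f : 'M[R]_(n, k) -> R)
    (X : 'M[R]_(n, k)) : 'M[R]_(n, k) :=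
  \matrix_(i < n, j < k) 'D_(delta_mx i j) f X.

Definition continuously_differentiable (R : realType) (n k : nat)
    (f : 'M[R]_(n, k) -> R) : Prop :=
  (forall X, differentiable f X) /\ continuous (gradmx f).

Definition psdmx (R : realType) (k : nat) (A : 'M[R]_k) : Prop :=
  A \is symmetricmx /\ forall v : 'cV[R]_k, 0 <= (v^T *m A *m v) 0 0.

Definition objective (R : realType) (n k : nat) (D : 'M[R]_(n, k))
    (phi psi : 'M[R]_(n, k) -> R) (X : 'M[R]_(n, k)) : R :=
  phi X + psi X * \tr (X^T *m D).

Definition nepv_mx (R : realType) (n k : nat) (D : 'M[R]_(n, k))
    (psi : 'M[R]_(n, k) -> R) (Hphi Hpsi : 'M[R]_(n, k) -> 'M[R]_n)
    (X : 'M[R]_(n, k)) : 'M[R]_n :=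
  Hphi X + \tr (X^T *m D) *: Hpsi X + psi X *: (D *m X^T + X *m D^T).

Definition nepv_solution (R : realType) (n k : nat)
    (H : 'M[R]_(n, k) -> 'M[R]_n) (X : 'M[R]_(n, k)) : Prop :=
  stiefel R n k X /\ exists L : 'M[R]_k, H X *m X = X *m L.

Definition D_regular (R : realType) (n k : nat) (D X : 'M[R]_(n, k)) : Prop :=
  psdmx (X^T *m D) /\ \rank (X^T *m D) = \rank D.

Definition stiefel_D (R : realType) (n k : nat) (D : 'M[R]_(n, k)) :
    set 'M[R]_(n, k) :=
  [set X | stiefel R n k X /\ \rank (X^T *m D) = \rank D].

Definition alignments (R : realType) (n k : nat) (f : 'M[R]_(n, k) -> R)
    (X : 'M[R]_(n, k)) : set 'M[R]_(n, k) :=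
  [set X *m Q | Q in [set Q : 'M[R]_k | stiefel R k k Q /\
     forall P : 'M[R]_k, stiefel R k k P -> f (X *m P) <= f (X *m Q)]].

(* An alignment is picked by choice: for the objective above and X in
   [stiefel_D D], alignments exist (the orthogonal group is compact) and H
   takes the same value at all of them.  The default value X of [xget] is used
   only if there is no alignment. *)
Definition aligned_mx (R : realType) (n k : nat) (f : 'M[R]_(n, k) -> R)
    (H : 'M[R]_(n, k) -> 'M[R]_n) (X : 'M[R]_(n, k)) : 'M[R]_n :=
  H (xget X (alignments f X)).

Definition aligned_nepv_solution (R : realType) (n k : nat)
    (D : 'M[R]_(n, k)) (G : 'M[R]_(n, k) -> 'M[R]_n) (X : 'M[R]_(n, k)) :
    Prop :=
  stiefel_D D X /\ exists L : 'M[R]_k, G X *m X = X *m L.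

(* Main.v *)
Require Import Defs.
From mathcomp Require Import all_boot all_order all_algebra.
From mathcomp Require Import all_classical all_reals all_analysis.
From mathcomp Require Import ring lra.
Import Order.TTheory GRing.Theory Num.Theory.
Import numFieldNormedType.Exports.

Local Open Scope classical_set_scope.
Local Open Scope ring_scope.

(** For orthogonal [Q], [f (X Q)] is an affine function of [tr (Q^T X^T D)] with
    positive slope [psi X].  Hence [Xt] is an alignment of [X] iff [M = Xt^T D]
    satisfies [tr (P^T M) <= tr M] for all orthogonal [P], which holds iff [M]
    is symmetric positive semidefinite: testing with one reflection gives
    [v^T M v >= 0], with a product of two reflections the symmetry, and the
    converse is [0 <= tr ((1 - P)^T M (1 - P)) = 2 (tr M - tr (P^T M))].  In the
    equality case [M P = M]; since [M] has the same row space as [D], also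
    [D P = D], so all alignments share the matrix [D Xt^T], hence [H]. *)

Lemma symmetricmxP (R : realType) (k : nat) (M : 'M[R]_k) :
  reflect (M^T = M) (M \is symmetricmx).
Proof.
apply: (iffP (is_hermitianmxP _ _ _)); rewrite expr0 scale1r map_mx_id //.
Qed.

(** First-order optimality: near [t = 0] the linear term dominates the quadratic one, whatever its
    sign. *)
Lemma linear_le_quadratic_eq0 {R : realType} (a b : R) :
  (forall t, t * b <= t ^+ 2 * a) -> b = 0.
Proof.
(* At this [t] the bound becomes [b ^+ 2 * c <= b ^+ 2 * a], and [c] exceeds [a] by at least 1. *)
move=> /(_ (b / (1 + `|a|))); set c := 1 + `|a| => h.
have c0 : 0 < c by rewrite /c ltr_pwDl.
have ac : a + 1 <= c by rewrite /c addrC lerD2l ler_norm.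
have : b ^+ 2 * c <= b ^+ 2 * a.
  have -> : b ^+ 2 * c = b / c * b * c ^+ 2 by field; exact: lt0r_neq0.
  have -> : b ^+ 2 * a = (b / c) ^+ 2 * a * c ^+ 2 by field; exact: lt0r_neq0.
  by rewrite ler_wpM2r ?sqr_ge0.
by move=> h2; apply/eqP; rewrite -sqrf_eq0; apply/eqP; nra.
Qed.

Lemma mxtrace_outer_mul {R : realType} {k : nat} (M : 'M[R]_k) (u v : 'cV[R]_k) :
  \tr (u *m v^T *m M) = (v^T *m M *m u) 0 0.
Proof. by rewrite -mulmxA mxtrace_mulC trace_mx11. Qed.

Lemma stiefel_mul {R : realType} {n k : nat} (X : 'M[R]_(n, k)) (Q : 'M[R]_k) :
  stiefel R n k X -> stiefel R k k Q -> stiefel R n k (X *m Q).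
Proof.
rewrite /stiefel /= => hX hQ.
by rewrite trmx_mul mulmxA -(mulmxA Q^T) hX mulmx1.
Qed.

Lemma stiefel_tr {R : realType} {k : nat} (Q : 'M[R]_k) :
  stiefel R k k Q -> stiefel R k k Q^T.
Proof. by rewrite /stiefel /= trmxK => /mulmx1C. Qed.

Lemma stiefel1 {R : realType} {k : nat} : stiefel R k k 1%:M.
Proof. by rewrite /stiefel /= trmx1 mulmx1. Qed.

(* For [v = 0] the division by zero makes this the identity, which is still
   orthogonal. *)
Definition reflection {R : realType} {k : nat} (v : 'cV[R]_k) : 'M[R]_k :=
  1%:M - (2 / (v^T *m v) 0 0) *: (v *m v^T).

Lemma reflection_tr {R : realType} {k : nat} (v : 'cV[R]_k) :
  (reflection v)^T = reflection v.
Proof. by rewrite /reflection linearB linearZ /= trmx1 trmx_mul trmxK. Qed.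

Lemma stiefel_reflection {R : realType} {k : nat} (v : 'cV[R]_k) :
  stiefel R k k (reflection v).
Proof.
rewrite /stiefel /= reflection_tr /reflection; set s := (v^T *m v) 0 0.
rewrite mulmxBl mul1mx mulmxBr mulmx1 -scalemxAl -scalemxAr.
have -> : v *m v^T *m (v *m v^T) = s *: (v *m v^T).
  by rewrite mulmxA -(mulmxA v) (mx11_scalar (v^T *m v)) mul_mx_scalar -scalemxAl.
rewrite !scalerA.
suff -> : 2 / s * (2 / s) * s = 2 / s + 2 / s.
  by rewrite scalerDl opprB addrK subrK.
have [->|s0] := eqVneq s 0; first by rewrite invr0; ring.
by field.
Qed.

(** * Trace maximality over the orthogonal group and semidefiniteness *)

Definition trace_maximal {R : realType} {k : nat} (M : 'M[R]_k) :=
  forall P, stiefel R k k P -> \tr (P^T *m M) <= \tr M.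

(** Reflecting along [v != 0] lowers the trace by [2 / (v^T v)] times the form at [v]. *)
Lemma trace_maximal_form_ge0 {R : realType} {k : nat} (M : 'M[R]_k) :
  trace_maximal M -> forall v : 'cV[R]_k, 0 <= (v^T *m M *m v) 0 0.
Proof.
move=> hM v; have := hM _ (stiefel_reflection v).
rewrite reflection_tr /reflection mulmxBl mul1mx -scalemxAl linearB linearZ /=.
rewrite mxtrace_outer_mul gerBl.
have [->|v0] := eqVneq v 0; first by move=> _; rewrite mulmx0 mxE.
rewrite pmulr_rge0 // divr_gt0 //.
have [i vi] : exists i, v i 0 != 0.
  apply/existsP; apply: contra_neqT v0 => /existsPn h.
  by apply/matrixP => i j; rewrite ord1 mxE; apply/eqP; rewrite -[_ == _]negbK.
rewrite mxE (bigD1 i) //= mxE ltr_pwDl //.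
  by rewrite -expr2 lt0r sqrf_eq0 vi sqr_ge0.
by apply: sumr_ge0 => j _; rewrite mxE -expr2 sqr_ge0.
Qed.

Lemma trace_maximal_sym {R : realType} {k : nat} (M : 'M[R]_k) :
  trace_maximal M -> M^T = M.
Proof.
move=> hM; apply/matrixP => i j; rewrite mxE.
have [->//|ij] := eqVneq i j.
apply/eqP; rewrite -subr_eq0; apply/eqP.
(* The two reflections used below compose to a rotation in the plane of [e i] and [e j]. Up to a
   positive factor, its trace loss is [t ^+ 2 * (M i i + M j j) - t * (M j i - M i j)]. *)
apply: (linear_le_quadratic_eq0 (M i i + M j j)) => t.
pose e (l : 'I_k) : 'cV[R]_k := delta_mx l 0.
pose v := e i + t *: e j.
have eE a b : (e a)^T *m e b = (a == b)%:R%:M.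
  rewrite trmx_delta [LHS]mx11_scalar; congr (_%:M).
  by rewrite -rowE mxE mxE eqxx andbT.
have eM a b : (e a)^T *m M *m e b = (M a b)%:M.
  by rewrite trmx_delta [LHS]mx11_scalar -rowE -colE !mxE.
have eii : (e i)^T *m e i = 1%:M by rewrite eE eqxx.
have eiv : (e i)^T *m v = 1%:M.
  by rewrite mulmxDr -scalemxAr !eE eqxx (negbTE ij) mulr0n raddf0 scaler0 addr0.
have vv : (v^T *m v) 0 0 = 1 + t ^+ 2.
  rewrite [v^T]linearD /= linearZ /= mulmxDl eiv -scalemxAl mulmxDr -scalemxAr.
  by rewrite !eE eqxx eq_sym (negbTE ij) !mxE /= !mulr1n add0r; ring.
have vMi : (v^T *m M *m e i) 0 0 = M i i + t * M j i.
  by rewrite [v^T]linearD /= linearZ /= !mulmxDl -!scalemxAl !eM !mxE /= !mulr1n.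
have vMv : (v^T *m M *m v) 0 0 = M i i + t * (M i j + M j i) + t ^+ 2 * M j j.
  rewrite mulmxDr -scalemxAr mxE vMi [v^T]linearD /= linearZ /=.
  by rewrite !mulmxDl -!scalemxAl !eM !mxE /= !mulr1n; ring.
have := hM _ (stiefel_mul _ _ (stiefel_reflection v) (stiefel_reflection (e i))).
rewrite trmx_mul !reflection_tr /reflection vv eii mxE eqxx mulr1n divr1.
rewrite mulmxBl mul1mx mulmxBr mulmx1 -scalemxAl -scalemxAr scalerA.
rewrite -(mulmxA (e i)) (mulmxA (e i)^T) eiv mul1mx !mulmxBl mul1mx -!scalemxAl.
rewrite !linearB !linearZ /= !mxtrace_outer_mul vMi vMv eM mxE eqxx mulr1n.
have t0 : 0 < 1 + t ^+ 2 by rewrite ltr_pwDl // sqr_ge0.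
rewrite -![_ *: _]/(_ * _) -subr_ge0 => h; rewrite -subr_ge0.
(* Multiplying the trace loss by [(1 + t ^+ 2) / 2] clears its denominators. *)
have {}h := divr_ge0 (mulr_ge0 h (ltW t0)) (ler0n R 2).
apply: le_trans h _; rewrite le_eqVlt; apply/orP; left; apply/eqP; field.
exact: lt0r_neq0.
Qed.

Lemma trace_maximal_psd {R : realType} {k : nat} (M : 'M[R]_k) :
  trace_maximal M -> psdmx M.
Proof.
move=> hM; split; first by apply/symmetricmxP; exact: trace_maximal_sym.
exact: trace_maximal_form_ge0.
Qed.

(** Expand the product: orthogonality turns the quadratic term in [P] into [\tr M], and symmetry of
    [M] makes the two cross terms equal. *)
Lemma psdmx_trace_gap {R : realType} {k : nat} (M P : 'M[R]_k) :
  M^T = M -> stiefel R k k P ->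
  \tr ((1%:M - P)^T *m M *m (1%:M - P)) = 2 * (\tr M - \tr (P^T *m M)).
Proof.
move=> sM hP; rewrite [(_ - P)^T]linearB /= trmx1 mulmxBl mul1mx mulmxBr mulmx1.
rewrite mulmxBl.
rewrite !linearB /= (mxtrace_mulC (P^T *m M)) mulmxA (mulmx1C hP) mul1mx.
have -> : \tr (M *m P) = \tr (P^T *m M).
  by rewrite -mxtrace_tr trmx_mul sM.
ring.
Qed.

Lemma mxtrace_congr {R : realType} {k : nat} (M N : 'M[R]_k) :
  \tr (N^T *m M *m N) = \sum_i ((col i N)^T *m M *m col i N) 0 0.
Proof.
apply: eq_bigr => i _; rewrite tr_col -row_mul -mulmxA colE mulmxA -colE !mxE.
by apply: eq_bigr => j _; rewrite !mxE.
Qed.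

Lemma psdmx_trace_maximal {R : realType} {k : nat} (M : 'M[R]_k) :
  psdmx M -> trace_maximal M.
Proof.
move=> [/symmetricmxP sM pM] P hP.
rewrite -subr_ge0 -(pmulr_rge0 _ (ltr0Sn R 1)) -psdmx_trace_gap //.
by rewrite mxtrace_congr; apply: sumr_ge0.
Qed.

Lemma symmetric_form_subZ {R : realType} {k : nat} (M : 'M[R]_k)
    (v w : 'cV[R]_k) (t : R) :
  M^T = M ->
  ((v - t *: w)^T *m M *m (v - t *: w)) 0 0 =
  (v^T *m M *m v) 0 0 - t * (2 * (w^T *m M *m v) 0 0)
  + t ^+ 2 * (w^T *m M *m w) 0 0.
Proof.
move=> sM; have vw : (v^T *m M *m w) 0 0 = (w^T *m M *m v) 0 0.
  by rewrite -trace_mx11 -mxtrace_tr trace_mx11 !trmx_mul trmxK sM mulmxA.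
rewrite -!trace_mx11 [(v - _)^T]linearB /= linearZ /= !mulmxBl !mulmxBr.
rewrite -!scalemxAl -!scalemxAr !(linearB, linearZ) /= !trace_mx11 vw.
by rewrite -![_ *: _]/(_ * _); ring.
Qed.

(** A zero of a nonnegative form is a minimizer, so the first variation [2 * (M *m v) i 0] vanishes
    in each coordinate direction. *)
Lemma psdmx_form_eq0 {R : realType} {k : nat} (M : 'M[R]_k) (v : 'cV[R]_k) :
  psdmx M -> (v^T *m M *m v) 0 0 = 0 -> M *m v = 0.
Proof.
move=> [/symmetricmxP sM pM] v0; apply/matrixP => i j; rewrite ord1 [RHS]mxE.
pose e : 'cV[R]_k := delta_mx i 0.
have <- : (e^T *m M *m v) 0 0 = (M *m v) i 0.
  by rewrite trmx_delta -mulmxA -rowE mxE.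
suff /eqP : 2 * (e^T *m M *m v) 0 0 = 0 by rewrite mulf_eq0 pnatr_eq0 => /eqP.
apply: (linear_le_quadratic_eq0 ((e^T *m M *m e) 0 0)) => t.
have := pM (v - t *: e); rewrite symmetric_form_subZ // v0 sub0r addrC.
by rewrite subr_ge0.
Qed.

(** A zero trace gap is a vanishing sum of nonnegative forms at the columns of [1 - P], so [M] kills
    each column. *)
Lemma psdmx_trace_eq {R : realType} {k : nat} (M P : 'M[R]_k) :
  psdmx M -> stiefel R k k P -> \tr (P^T *m M) = \tr M -> M *m P = M.
Proof.
move=> psdM hP trE; have [/symmetricmxP sM pM] := psdM.
have := psdmx_trace_gap _ _ sM hP; rewrite trE subrr mulr0 mxtrace_congr.
move=> /eqP; rewrite psumr_eq0 => [/allP h|i _]; last exact: pM.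
apply/esym/eqP; rewrite -subr_eq0 -{1}[M]mulmx1 -mulmxBr; apply/eqP/matrixP => i j.
have /= /eqP/(psdmx_form_eq0 _ _ psdM) := h j (mem_index_enum _).
by rewrite -[RHS]/(0 i j) => /matrixP/(_ i 0); rewrite colE mulmxA -colE !mxE.
Qed.

(** * Alignments and D-regularity *)

Lemma objective_mul {R : realType} {n k : nat} (D : 'M[R]_(n, k))
    (phi psi : 'M[R]_(n, k) -> R) (X : 'M[R]_(n, k)) (Q : 'M[R]_k) :
  unitarily_invariant phi -> unitarily_invariant psi -> stiefel R k k Q ->
  objective D phi psi (X *m Q) = phi X + psi X * \tr (Q^T *m (X^T *m D)).
Proof.
by move=> hphi hpsi hQ; rewrite /objective hphi // hpsi // trmx_mul mulmxA.
Qed.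

Lemma alignmentsP {R : realType} {n k : nat} (D : 'M[R]_(n, k))
    (phi psi : 'M[R]_(n, k) -> R) (X Xt : 'M[R]_(n, k)) :
  unitarily_invariant phi -> unitarily_invariant psi -> 0 < psi X ->
  alignments (objective D phi psi) X Xt <->
  exists2 Q, stiefel R k k Q & X *m Q = Xt /\ psdmx (Xt^T *m D).
Proof.
move=> hphi hpsi psi0; split=> [[Q [hQ maxQ] <-]|[Q hQ [<- psdQ]]].
  exists Q => //; split=> //; apply: trace_maximal_psd => P hP.
  (* Competitors are translated by [Q], so that maximality at [Q] becomes maximality at the identity
     for [(X Q)^T D]. *)
  have hQP := stiefel_mul _ _ hQ hP.
  have := maxQ _ hQP; rewrite !objective_mul // lerD2l ler_pM2l //.
  by rewrite !trmx_mul !mulmxA.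
exists Q => //; split=> // P hP.
rewrite !objective_mul // lerD2l ler_pM2l //.
have := psdmx_trace_maximal _ psdQ _ (stiefel_mul _ _ (stiefel_tr _ hQ) hP).
by rewrite !trmx_mul trmxK -!mulmxA (mulmxA Q) (mulmx1C hQ) mul1mx.
Qed.

Lemma D_regular_mul_eq {R : realType} {n k : nat} (D X : 'M[R]_(n, k))
    (P : 'M[R]_k) :
  D_regular D X -> stiefel R k k P -> psdmx ((X *m P)^T *m D) ->
  D *m P = D.
Proof.
move=> [psdX rkX] hP psdXP.
(* Both [X^T D] and [P^T X^T D] are trace maximal, so each trace bounds the other. *)
have trE : \tr (P^T *m (X^T *m D)) = \tr (X^T *m D).
  apply/eqP; rewrite eq_le psdmx_trace_maximal //=.
  have := psdmx_trace_maximal _ psdXP _ (stiefel_tr _ hP).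
  by rewrite trmxK trmx_mul -mulmxA mulmxA (mulmx1C hP) mul1mx.
have MP := psdmx_trace_eq _ _ psdX hP trE.
(* Equal ranks give [D] and [X^T D] the same row space, so [D = C X^T D] inherits invariance under
   right multiplication by [P]. *)
have /submxP [C DE] : (D <= X^T *m D)%MS.
  by rewrite -(geq_leqif (mxrank_leqif_sup (submxMl _ _))) rkX.
by rewrite {1}DE -mulmxA MP -DE.
Qed.

Lemma alignments_D_regular {R : realType} {n k : nat} (D : 'M[R]_(n, k))
    (phi psi : 'M[R]_(n, k) -> R) (X Xt : 'M[R]_(n, k)) :
  unitarily_invariant phi -> unitarily_invariant psi -> 0 < psi X ->
  stiefel_D D X -> alignments (objective D phi psi) X Xt -> D_regular D Xt.
Proof.
move=> hphi hpsi psi0 [_ rkX] /alignmentsP[] // Q hQ [<- psdQ]; split=> //.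
rewrite trmx_mul -mulmxA -rkX; apply: eqmx_rank.
rewrite submxMl /=; apply/submxP; exists Q.
by rewrite (mulmxA Q) (mulmx1C hQ) mul1mx.
Qed.

(** This makes [aligned_mx] independent of the alignment that [xget] picks. *)
Lemma nepv_mx_alignments {R : realType} {n k : nat} (D : 'M[R]_(n, k))
    (phi psi : 'M[R]_(n, k) -> R) (Hphi Hpsi : 'M[R]_(n, k) -> 'M[R]_n)
    (X Y Z : 'M[R]_(n, k)) :
  unitarily_invariant phi -> unitarily_invariant psi ->
  unitarily_invariant Hphi -> unitarily_invariant Hpsi ->
  0 < psi X -> stiefel_D D X ->
  alignments (objective D phi psi) X Y ->
  alignments (objective D phi psi) X Z ->
  nepv_mx D psi Hphi Hpsi Y = nepv_mx D psi Hphi Hpsi Z.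
Proof.
move=> hphi hpsi hHphi hHpsi psi0 XD aY aZ.
have regY := alignments_D_regular _ _ _ _ _ hphi hpsi psi0 XD aY.
have [Q hQ [YE _]] := (alignmentsP _ _ _ _ _ hphi hpsi psi0).1 aY.
have [S hS [ZE psdZ]] := (alignmentsP _ _ _ _ _ hphi hpsi psi0).1 aZ.
have hP := stiefel_mul _ _ (stiefel_tr _ hQ) hS.
(* Two alignments differ by an orthogonal factor [P]. It fixes [D] on the right, hence preserves
   [D Y^T], its transpose and its trace; invariance handles the other factors. *)
have {}ZE : Z = Y *m (Q^T *m S).
  by rewrite -YE -ZE -!mulmxA (mulmxA Q) (mulmx1C hQ) mul1mx.
move: (Q^T *m S) hP ZE => P hP ZE; rewrite ZE in psdZ *.
have DP := D_regular_mul_eq _ _ _ regY hP psdZ.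
have DPt : D *m P^T = D by rewrite -{1}DP -mulmxA (mulmx1C hP) mulmx1.
have PDt : P *m D^T = D^T by rewrite -[P]trmxK -trmx_mul DPt.
rewrite /nepv_mx hHphi // hHpsi // hpsi // trmx_mul (mulmxA D) DPt.
by rewrite -(mulmxA Y P) PDt -mulmxA [in RHS]mxtrace_mulC -mulmxA DPt mxtrace_mulC.
Qed.

Theorem theorem5p1 (R : realType) (n k : nat) (D : 'M[R]_(n, k))
    (phi psi : 'M[R]_(n, k) -> R) (Hphi Hpsi : 'M[R]_(n, k) -> 'M[R]_n)
    (k_ge1 : (1 <= k)%N) (k_le_n : (k <= n)%N)
    (phi_C1 : continuously_differentiable phi)
    (psi_C1 : continuously_differentiable psi)
    (phi_inv : unitarily_invariant phi)
    (psi_inv : unitarily_invariant psi)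
    (psi_gt0 : forall X, stiefel R n k X -> 0 < psi X)
    (Hphi_cont : continuous Hphi) (Hpsi_cont : continuous Hpsi)
    (Hphi_sym : forall X, Hphi X \is symmetricmx)
    (Hpsi_sym : forall X, Hpsi X \is symmetricmx)
    (Hphi_inv : unitarily_invariant Hphi)
    (Hpsi_inv : unitarily_invariant Hpsi)
    (Hphi_grad : forall X, stiefel R n k X -> gradmx phi X = Hphi X *m X)
    (Hpsi_grad : forall X, stiefel R n k X -> gradmx psi X = Hpsi X *m X)
    (X : 'M[R]_(n, k)) (X_OD : stiefel_D D X) :
  let f := objective D phi psi in
  let H := nepv_mx D psi Hphi Hpsi in
  let G := aligned_mx f H in
  (nepv_solution H X -> D_regular D X -> aligned_nepv_solution D G X) /\
  (aligned_nepv_solution D G X ->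
   forall Xt, alignments f X Xt -> nepv_solution H Xt /\ D_regular D Xt).
Proof.
move=> f H G.
have psi0 := psi_gt0 _ X_OD.1.
have HE := nepv_mx_alignments _ _ _ _ _ _ _ _ phi_inv psi_inv Hphi_inv Hpsi_inv
  psi0 X_OD.
split=> [[_ [L HX]] [psdX _]|[_ [L GX]] Xt aXt].
  split=> //; exists L; rewrite -HX /G /aligned_mx; congr (_ *m X).
  (* Since [X^T D] is positive semidefinite, [X] is its own alignment, whence [G X = H X]. *)
  have aX : alignments f X X.
    apply/alignmentsP => //; exists 1%:M; first exact: stiefel1.
    by rewrite mulmx1.
  (* The set of alignments is nonempty, so [xget] returns a member of it. *)
  by apply: HE => //; apply: xgetPex; exists X.
split; last exact: alignments_D_regular aXt.
have [Q hQ [XtE _]] := (alignmentsP _ _ _ _ _ phi_inv psi_inv psi0).1 aXt.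
split; first by rewrite -XtE; exact: stiefel_mul X_OD.1 hQ.
(* From [G X *m X = X *m L], multiply by [Q] on the right and insert [Q *m Q^T = 1] after [X]. *)
exists (Q^T *m L *m Q).
have -> : H Xt = G X by apply: HE => //; apply: xgetPex; exists Xt.
by rewrite -XtE mulmxA GX -!mulmxA (mulmxA Q) (mulmx1C hQ) mul1mx.
Qed.
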